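(* If $E\subseteq\mathbb{Q}^2$ has positive upper Banach density, then $$P(E)=\{xy:(x,y)\in E-E\}=\mathbb{Q}.$$
   Context: For $E\subseteq\mathbb{Q}^2$, $E-E=\{u-v:u,v\in E\}$ and $P(E):=\{xy:(x,y)\in E-E\}$. Upper Banach density is taken in the discrete amenable group $(\mathbb{Q}^d,+)$ (here $d=2$): for $E\subseteq\mathbb{Q}^d$, $$d^\star(E):=\sup_{(F_n)}\limsup_{n\to\infty}\frac{|E\cap F_n|}{|F_n|},$$ the supremum being over all Følner sequences $(F_n)$ in $\mathbb{Q}^d$, i.e. sequences of nonempty finite sets with $|(g+F_n)\triangle F_n|/|F_n|\to0$ for every $g\in\mathbb{Q}^d$. *)

(* Defs.v *)
From HB Require Import structures.
From mathcomp Require Import all_boot all_order all_algebra finmap.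
From mathcomp Require Import all_classical all_reals all_analysis.

Set Implicit Arguments.
Unset Strict Implicit.
Unset Printing Implicit Defensive.

Import Order.TTheory GRing.Theory Num.Theory.
Import numFieldNormedType.Exports.

Local Open Scope classical_set_scope.
Local Open Scope ring_scope.

Definition fset_translate (G : zmodType) (g : G) (F : {fset G}) : {fset G} :=
  [fset (g + x)%R | x in F]%fset.

Definition fset_symdiff (G : choiceType) (A B : {fset G}) : {fset G} :=
  ((A `\` B) `|` (B `\` A))%fset.

Definition is_folner (R : realType) (G : zmodType) (F : nat -> {fset G}) : Prop :=
  (forall n, F n != fset0) /\
  (forall g : G,
     #|` fset_symdiff (fset_translate g (F n)) (F n)|%:R / #|` F n|%:R
       @[n --> \oo] --> (0 : R)).

Definition density_on (R : realType) (G : zmodType) (E : set G) (F : {fset G}) : R :=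
  #|` [fset x in F | x \in E]%fset|%:R / #|` F|%:R.

Definition upper_density_along (R : realType) (G : zmodType)
    (E : set G) (F : nat -> {fset G}) : \bar R :=
  limn_esup (fun n => (density_on R E (F n))%:E).

Definition upper_banach_density (R : realType) (G : zmodType) (E : set G) : \bar R :=
  ereal_sup [set upper_density_along R E F | F in @is_folner R G].

Definition difference_set (G : zmodType) (E : set G) : set G :=
  [set u - v | u in E & v in E].

Definition product_set (E : set (rat * rat)) : set rat :=
  [set p.1 * p.2 | p in difference_set E].

(* Main.v *)
Require Import Defs.
From mathcomp Require Import all_boot all_order all_algebra finmap.
From mathcomp Require Import all_classical all_reals all_analysis.
From mathcomp Require Import ring lra.

Set Implicit Arguments.
Unset Strict Implicit.
Unset Printing Implicit Defensive.

Import Order.TTheory GRing.Theory Num.Theory.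
Import numFieldNormedType.Exports.

Local Open Scope classical_set_scope.
Local Open Scope ring_scope.

(** Positive density gives a bounded positive definite function psi on the
group which is at most some - c < 0 off the difference set E - E: the limit of
the autocovariances of the indicator of E, centred at its density along a
Folner sequence [dense_positive_definite].  If the nonzero rational r is not a
value of xy on E - E, then psi <= - c on the whole hyperbola xy = r.  The
contradiction will be that positive definiteness forces a nonnegative value
there.

The hyperbola is preserved by the torus maps (u, v) -> (t u, v / t), which are
commuting automorphisms of Q^2.  The properties of psi are linear inequalities
permuted by these maps, so averaging over the torus and passing to the limit
gives a psi that is moreover torus-invariant [invariant_solution].  Then
psi (u, v) depends only on the product uv as soon as v is nonzero, say
psi (u, v) = h (u v), and psi is constant on the punctured axis v = 0.

Think of psi (w - w') as the inner product of vectors f_w, f_w'.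

- As psi is constant on the punctured axis, the vectors f_(u, 0) - f_(u', 0)
  for disjoint pairs (u, u') are orthogonal and of bounded norm, while their
  inner products with f_(0, -1) are h(u) - h(u').  By Bessel's inequality h
  oscillates by at most e outside a finite set [profile_oscillation].

- For nonzero s and t, the vectors D_v = f_(s/v, v) - f_(t/v, v) all have inner
  product h(s) - h(t) with f_0.  For v and v' in a sparse geometric progression
  the inner product of D_v and D_v' is an alternating sum of four values of h at
  large arguments, hence small.  Averaging N such vectors and using
  Cauchy-Schwarz gives h(s) = h(t) [profile_le].

- So h is constant away from 0, and the vectors f_(i, i) have constant pairwise
  inner product; any number of them may be taken, so this constant is
  nonnegative [profile_ge0]. *)

(** * Finitary linear inequalities and invariant solutions *)

Section LinearSystems.
Variables (R : realType) (X : choiceType).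
Implicit Types (l : seq (R * X)) (psi : X -> R).

Definition lin l psi : R := \sum_(p <- l) p.1 * psi p.2.

(** A pair (l, b) encodes the inequality lin l psi <= b on an unknown function
psi; a set of such pairs is a system. *)
Definition solves (S : set (seq (R * X) * R)) psi :=
  forall l b, S (l, b) -> lin l psi <= b.

Lemma lin1 a x psi : lin [:: (a, x)] psi = a * psi x.
Proof. by rewrite /lin big_seq1. Qed.

Lemma lin2 a x a' x' psi :
  lin [:: (a, x); (a', x')] psi = a * psi x + a' * psi x'.
Proof. by rewrite /lin big_cons big_seq1. Qed.

Lemma lin_continuous l :
  continuous (lin l : {ptws X -> R^o} -> R^o).
Proof.
elim: l => [|[a x] l IH] f.
  rewrite (_ : lin [::] = cst 0); first exact: cst_continuous.
  by apply/funext => g; rewrite /lin big_nil.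
rewrite (_ : lin ((a, x) :: l) = (fun g => a * g x) \+ lin l); last first.
  by apply/funext => g; rewrite /lin big_cons.
apply: continuousD; last exact: IH.
apply: continuousM; first exact: cst_continuous.
exact: (@proj_continuous X (fun=> R^o) x f).
Qed.

(** By Tychonoff's theorem the sequence has a cluster point for pointwise
convergence; an inequality involves finitely many values, so it is an open
condition to violate it and the cluster point cannot. *)
Lemma asymptotic_solution (M : R) (S : set (seq (R * X) * R))
    (psi : nat -> X -> R) :
    (forall n x, `|psi n x| <= M) ->
    (forall l b, S (l, b) -> forall e, 0 < e ->
       \forall n \near \oo, lin l (psi n) <= b + e) ->
  exists2 phi, solves S phi & forall x, `|phi x| <= M.
Proof.
move=> bnd asym.
have cpt : compact [set f : {ptws X -> R^o} | forall x, `[- M, M]%classic (f x)].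
  exact: (@tychonoff X (fun=> R^o) (fun=> `[- M, M]%classic) (fun=> @segment_compact _ _ _)).
have psiF : (psi @ \oo) [set f | forall x, `[- M, M]%classic (f x)].
  by exists 0%N => // n _ x; rewrite /= in_itv /= -ler_norml.
have [phi [/= phiM phicl]] := cpt (psi @ \oo) _ psiF; exists phi; last first.
  by move=> x; have := phiM x; rewrite /= in_itv /= -ler_norml.
move=> l b Slb; rewrite leNgt; apply/negP => blt.
pose e := (lin l phi - b) / 2.
have e0 : 0 < e by rewrite /e; lra.
have nb : nbhs (phi : {ptws X -> R^o}) [set f | b + e < lin l f].
  have := @lin_continuous l phi.
  move=> /(_ [set y | b + e < y]); apply.
  by apply: open_nbhs_nbhs; split; [exact: open_gt|rewrite /= /e; lra].
have [f [/= H1 H2]] := phicl [set f | lin l f <= b + e] _ (asym _ _ Slb _ e0) nb.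
by move: H1; rewrite leNgt => /negP; apply.
Qed.

Lemma solvesU (S1 S2 : set (seq (R * X) * R)) psi :
  solves (S1 `|` S2) psi <-> solves S1 psi /\ solves S2 psi.
Proof.
split=> [h|[h1 h2] l b [/h1|/h2]//].
by split=> l b ?; apply: h; [left|right].
Qed.

Definition pull (T : X -> X) l := [seq (p.1, T p.2) | p <- l].

Lemma lin_pull T l psi : lin (pull T l) psi = lin l (psi \o T).
Proof. by rewrite /lin big_map. Qed.

Definition invariance (T : X -> X) : set (seq (R * X) * R) :=
  [set c | exists x, c = ([:: (1, T x); (-1, x)], 0)
                  \/ c = ([:: (1, x); (-1, T x)], 0)].

Lemma solves_invariance T psi :
  solves (invariance T) psi <-> forall x, psi (T x) = psi x.
Proof.
split=> [h x|h l b [x [] [-> ->]]]; last 2 first.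
- by rewrite lin2 h mul1r mulN1r subrr.
- by rewrite lin2 h mul1r mulN1r subrr.
have := h _ _ (ex_intro _ x (or_introl erefl)).
have := h _ _ (ex_intro _ x (or_intror erefl)).
by rewrite !lin2 !mul1r !mulN1r !subr_le0 => ? ?; apply/eqP; rewrite eq_le; apply/andP.
Qed.

Definition stable (T : X -> X) (S : set (seq (R * X) * R)) :=
  forall l b, S (l, b) -> S (pull T l, b).

Lemma invariance_stable T U : (forall x, T (U x) = U (T x)) ->
  stable U (invariance T).
Proof.
move=> TU l b [x [] [-> ->]]; exists (U x).
- by left; rewrite /pull /= TU.
- by right; rewrite /pull /= TU.
Qed.

Lemma stableU T (S1 S2 : set (seq (R * X) * R)) :
  stable T S1 -> stable T S2 -> stable T (S1 `|` S2).
Proof. by move=> h1 h2 l b [/h1|/h2]; [left|right]. Qed.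

Lemma solves_iter T S psi k :
  stable T S -> solves S psi -> solves S (psi \o iter k T).
Proof.
move=> st; elim: k => // k IH sol l b Slb.
have := IH sol _ _ (st _ _ Slb).
rewrite lin_pull; congr (lin l _ <= b).
by apply/funext => x; rewrite /= -iterSr.
Qed.

Definition cesaro (T : X -> X) psi (K : nat) (x : X) : R :=
  K.+1%:R^-1 * \sum_(k < K.+1) psi (iter k T x).

Lemma lin_cesaro T psi K l :
  lin l (cesaro T psi K) = K.+1%:R^-1 * \sum_(k < K.+1) lin l (psi \o iter k T).
Proof.
rewrite /lin exchange_big mulr_sumr; apply: eq_bigr => p _ /=.
by rewrite /cesaro mulrCA -mulr_sumr.
Qed.

Lemma mean_le (K : nat) (f : nat -> R) b : (forall k, f k <= b) ->
  K.+1%:R^-1 * \sum_(k < K.+1) f k <= b.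
Proof.
move=> fb; rewrite ler_pdivrMl ?ltr0Sn //.
apply: (le_trans (ler_sum _ (fun (k : 'I_K.+1) _ => fb k))).
by rewrite sumr_const card_ord mulr_natl.
Qed.

Lemma cesaro_shift T psi K x : K.+1%:R * (cesaro T psi K (T x) - cesaro T psi K x)
  = psi (iter K.+1 T x) - psi x.
Proof.
rewrite /cesaro mulrBr !mulrA divff ?pnatr_eq0 // !mul1r.
rewrite big_ord_recr [X in _ - X]big_ord_recl /=.
under eq_bigr do rewrite -iterSr.
rewrite -iterSr iterS opprD [- psi x - _]addrC addrA; congr (_ - _).
by rewrite addrAC subrr add0r.
Qed.

(** Markov-Kakutani for one map: the Cesaro means of psi along the orbits of T
still solve S, since S is T-stable, and they are T-invariant up to 2 M / (K + 1). *)
Lemma invariant_solution1 M S T psi : stable T S -> solves S psi ->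
  (forall x, `|psi x| <= M) ->
  exists phi, [/\ solves S phi, forall x, `|phi x| <= M & forall x, phi (T x) = phi x].
Proof.
move=> st sol bnd.
have solK K : solves S (cesaro T psi K).
  move=> l b Slb; rewrite lin_cesaro.
  by apply: (@mean_le K (fun k => lin l (psi \o iter k T))) => k; exact: solves_iter Slb.
have bndK K x : `|cesaro T psi K x| <= M.
  rewrite /cesaro normrM ger0_norm ?invr_ge0 ?ler0n //.
  apply: le_trans (@mean_le K (fun k => `|psi (iter k T x)|) M _) => //.
  by rewrite ler_wpM2l ?invr_ge0 ?ler0n // ler_norm_sum.
have [|phi /solvesU[solphi /solves_invariance invphi] phiM] :=
    @asymptotic_solution M (S `|` invariance T) (cesaro T psi) bndK; last by exists phi.
move=> l b [Slb|[x lb]] e e0.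
  by apply: nearW => K; rewrite (le_trans (solK K _ _ Slb)) // lerDl ltW.
have M0 : 0 <= M by apply: le_trans (bnd x).
near=> K.
have K0 : 0 < K.+1%:R :> R by rewrite ltr0Sn.
have big : 2 * M <= K.+1%:R * e.
  rewrite -ler_pdivrMr // (@le_trans _ _ K%:R) ?ler_nat //.
  by near: K; exact: nbhs_infty_ger.
have eqn := cesaro_shift T psi K x.
have b1 := bnd x; have b2 := bnd (iter K.+1 T x).
rewrite !ler_norml in b1 b2.
have K' : K.+1%:R * `|cesaro T psi K (T x) - cesaro T psi K x| <= K.+1%:R * e.
  rewrite -[X in X * `|_|](ger0_norm (ltW K0)) -normrM eqn ler_norml; lra.
rewrite ler_pM2l // ler_norml in K'.
by case: lb => -[-> ->]; rewrite lin2; lra.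
Unshelve. all: by end_near. Qed.

(** Invariance under T i is itself a system of linear inequalities, stable under
the maps that commute with T i.  It can therefore be added to S before the
averaging over the next map is carried out, and compactness handles countably
many maps. *)
Theorem invariant_solution M S (T : nat -> X -> X) psi :
  (forall i, stable (T i) S) -> (forall i j x, T i (T j x) = T j (T i x)) ->
  solves S psi -> (forall x, `|psi x| <= M) ->
  exists phi, [/\ solves S phi, forall x, `|phi x| <= M
                & forall i x, phi (T i x) = phi x].
Proof.
move=> st com sol bnd.
pose Sj j := S `|` \bigcup_(i in [set i | (i < j)%N]) invariance (T i).
have solj j : exists phi, solves (Sj j) phi /\ forall x, `|phi x| <= M.
  elim: j => [|j [phi [solphi phiM]]].
    exists psi; split=> //; apply/solvesU; split=> // l b [i] //.
  have [|chi [solchi chiM inv]] := @invariant_solution1 M (Sj j) (T j) phi _ solphi phiM.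
    apply: stableU => // l b [i ij Slb]; exists i => //.
    exact: (@invariance_stable (T i) (T j)).
  exists chi; split=> //; move/solvesU: solchi => [h1 h2].
  apply/solvesU; split=> // l b [i /=]; rewrite ltnS leq_eqVlt => /orP[/eqP->|ij] Ti.
    by move/solves_invariance: inv; apply.
  by apply: h2; exists i.
have [phi_ phi_P] := choice solj.
have [|phi /solvesU[solphi invphi] phiM] :=
    @asymptotic_solution M (S `|` \bigcup_i invariance (T i)) phi_ (fun j => (phi_P j).2).
  move=> l b Slb e e0; suff : \forall j \near \oo, lin l (phi_ j) <= b.
    by apply: filterS => j /le_trans; apply; rewrite lerDl ltW.
  case: Slb => [Slb|[i _ Slb]].
    by apply: nearW => j; apply: (phi_P j).1; left.
  by exists i.+1 => // j /= ij; apply: (phi_P j).1; right; exists i.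
exists phi; split=> // i; apply/solves_invariance => l b Tlb.
by apply: invphi; exists i.
Qed.

End LinearSystems.

(** * A positive definite function attached to a set of positive density *)

Section Density.
Variables (R : realType) (G : zmodType).
Implicit Types (F : {fset G}) (phi : G -> R) (E : set G).

Definition avg F phi : R := (\sum_(y <- F) phi y) / #|` F|%:R.

Definition displacement F (s : G) : R :=
  #|` fset_symdiff (fset_translate s F) F|%:R / #|` F|%:R.

Lemma card_fset_gt0 F : F != fset0 -> 0 < #|` F|%:R :> R.
Proof. by rewrite ltr0n cardfs_gt0. Qed.

Lemma sum_fset_le1 F phi : (forall y, `|phi y| <= 1) ->
  `|\sum_(y <- F) phi y| <= #|` F|%:R.
Proof.
move=> b; apply: le_trans (ler_norm_sum _ _ _) _.
by rewrite card_fset_sum1 natr_sum; apply: ler_sum.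
Qed.

Lemma avgD F phi psi : avg F (fun y => phi y + psi y) = avg F phi + avg F psi.
Proof. by rewrite /avg big_split mulrDl. Qed.

Lemma avgZ F a phi : avg F (fun y => a * phi y) = a * avg F phi.
Proof. by rewrite /avg -mulr_sumr mulrA. Qed.

Lemma avg_cst F a : F != fset0 -> avg F (fun=> a) = a.
Proof.
move=> /card_fset_gt0 F0; rewrite /avg -[a in RHS](mulfK (lt0r_neq0 F0)).
congr (_ / _); rewrite card_fset_sum1 natr_sum mulr_sumr.
by apply: eq_bigr => y _; rewrite mulr1.
Qed.

Lemma avg_sum F I (r : seq I) (f : I -> G -> R) :
  avg F (fun y => \sum_(i <- r) f i y) = \sum_(i <- r) avg F (f i).
Proof. by rewrite /avg exchange_big mulr_suml. Qed.

Lemma avg_ge0 F phi : (forall y, 0 <= phi y) -> 0 <= avg F phi.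
Proof. by move=> p; rewrite /avg divr_ge0 ?ler0n // sumr_ge0. Qed.

Lemma avg_le1 F phi : F != fset0 -> (forall y, `|phi y| <= 1) -> `|avg F phi| <= 1.
Proof.
move=> /card_fset_gt0 F0 b; rewrite /avg normrM normfV normr_nat.
by rewrite ler_pdivrMr // mul1r sum_fset_le1.
Qed.

(** The two averages run over F and its translate, and the common part of these
two sets cancels. *)
Lemma avg_shift F phi s : F != fset0 -> (forall y, `|phi y| <= 1) ->
  `|avg F (fun y => phi (s + y)) - avg F phi| <= displacement F s.
Proof.
move=> F0 b; have F1 := card_fset_gt0 F0.
rewrite /avg /displacement -mulrBl normrM normfV normr_nat.
rewrite ler_pM2r ?invr_gt0 //.
have -> : \sum_(y <- F) phi (s + y) = \sum_(z <- fset_translate s F) phi z.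
  by rewrite /fset_translate big_imfset //= => y z _ _ /addrI.
set A := fset_translate s F.
have split_by (U V : {fset G}) : \sum_(y <- U) phi y =
    \sum_(y <- (U `&` V)%fset) phi y + \sum_(y <- (U `\` V)%fset) phi y.
  rewrite (big_fsetID _ (mem V)); congr (_ + _).
  - by apply: eq_fbigl => y; rewrite !inE.
  - by apply: eq_fbigl => y; rewrite !inE andbC.
rewrite (split_by A F) (split_by F A) fsetIC.
rewrite [X in `|X|](_ : _ = \sum_(y <- (A `\` F)%fset) phi y
                       - \sum_(y <- (F `\` A)%fset) phi y); last by ring.
apply: le_trans (ler_normB _ _) _.
rewrite /fset_symdiff cardfsU (_ : ((A `\` F) `&` (F `\` A))%fset = fset0).
  by rewrite cardfs0 subn0 natrD lerD // sum_fset_le1.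
by apply/fsetP => y; rewrite !inE; case: (y \in A); case: (y \in F).
Qed.

Lemma density_on_avg E F :
  density_on R E F = avg F (fun y => (y \in E)%:R).
Proof.
rewrite /density_on /avg card_fset_sum1 natr_sum; congr (_ / _).
by rewrite big_fset big_mkcond; apply: eq_bigr => y _ /=; case: (y \in E).
Qed.

(** The form of the Folner condition that passes to subsequences at once. *)
Definition folner_eps (F : nat -> {fset G}) :=
  (forall n, F n != fset0) /\
  (forall s e, 0 < e -> \forall n \near \oo, displacement (F n) s <= e).

(** A subsequence of a Folner sequence is Folner; it is chosen to turn a positive
upper limit into a uniform lower bound. *)
Lemma dense_folner E : (0%E < upper_banach_density R E)%E ->
  exists (F : nat -> {fset G}) (c : R), [/\ folner_eps F, 0 < c & forall n, c <= density_on R E (F n)].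
Proof.
move=> /ereal_sup_gt[_ [F [F0 Fcvg] <-]] d0.
have [c c0 dc] : exists2 c : R, 0 < c & (c%:E < upper_density_along R E F)%E.
  case: (upper_density_along R E F) d0 => [d||] // d0.
    by exists (d / 2); rewrite ?lte_fin; rewrite lte_fin in d0; lra.
  by exists 1; rewrite ?ltry.
have freq N : exists n, (N <= n)%N /\ c <= density_on R E (F n).
  apply: contrapT => no; move: dc; apply/negP; rewrite -leNgt.
  rewrite /upper_density_along /limn_esup /limf_esup; apply: ge_ereal_inf.
  exists (ereal_sup ((fun n => (density_on R E (F n))%:E) @` [set n | (N <= n)%N])).
    by exists [set n | (N <= n)%N] => //; exists N.
  apply: ub_ereal_sup => _ [n /= Nn <-]; rewrite lee_fin leNgt.
  by apply/negP => /ltW cn; apply: no; exists n.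
have [k kP] := choice freq.
exists (F \o k), c; split=> //; last by move=> n; exact: (kP n).2.
split=> [n|s e e0]; first exact: F0.
have /cvgrPdist_le/(_ e e0) [N _ HN] := Fcvg s.
exists N => // n /= Nn.
have := HN (k n) (leq_trans Nn (kP n).1); rewrite /= sub0r normrN => h.
exact: le_trans (ler_norm _) h.
Qed.

Definition quad (l : seq (R * G)) phi : R :=
  \sum_(p <- l) \sum_(q <- l) p.1 * q.1 * phi (p.2 - q.2).

Definition psd_system : set (seq (R * G) * R) :=
  [set c | exists l, c = ([seq (- (p.1 * q.1), p.2 - q.2) | p <- l, q <- l], 0)].

Lemma solves_psd phi : solves psd_system phi <-> forall l, 0 <= quad l phi.
Proof.
have E l : lin [seq (- (p.1 * q.1), p.2 - q.2) | p <- l, q <- l] phi = - quad l phi.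
  rewrite /lin big_allpairs_dep /quad -sumrN; apply: eq_bigr => p _.
  by rewrite -sumrN; apply: eq_bigr => q _; rewrite mulNr.
split=> [h l|h l b [m [-> ->]]].
  by have := h _ _ (ex_intro _ l erefl); rewrite E oppr_le0.
by rewrite E oppr_le0.
Qed.

Definition upper_system (D : set G) (b : R) : set (seq (R * G) * R) :=
  [set c | exists2 w, D w & c = ([:: (1, w)], b)].

Lemma solves_upper D b phi :
  solves (upper_system D b) phi <-> forall w, D w -> phi w <= b.
Proof.
split=> [h w Dw|h l b' [w Dw [-> ->]]]; last by rewrite lin1 mul1r h.
by have := h _ _ (ex_intro2 _ _ w Dw erefl); rewrite lin1 mul1r.
Qed.

Definition autocov F (f : G -> R) (w : G) : R := avg F (fun y => f y * f (w + y)).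

(** Averages of f (p + y) f (q + y) form a Gram matrix, and each differs from the
autocovariance at p - q by a translation of F by q. *)
Lemma quad_autocov F (f : G -> R) l e : F != fset0 -> (forall y, `|f y| <= 1) ->
  (forall q, q \in l -> displacement F q.2 <= e) ->
  - (\sum_(p <- l) \sum_(q <- l) `|p.1 * q.1|) * e <= quad l (autocov F f).
Proof.
move=> F0 f1 small.
have sq : 0 <= \sum_(p <- l) \sum_(q <- l)
    p.1 * q.1 * avg F (fun y => f (p.2 + y) * f (q.2 + y)).
  have -> : \sum_(p <- l) \sum_(q <- l)
      p.1 * q.1 * avg F (fun y => f (p.2 + y) * f (q.2 + y))
      = avg F (fun y => (\sum_(p <- l) p.1 * f (p.2 + y)) ^+ 2).
    rewrite (_ : (fun y => _ ^+ 2) = fun y => \sum_(p <- l) \sum_(q <- l)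
        p.1 * q.1 * (f (p.2 + y) * f (q.2 + y))).
      rewrite avg_sum; apply: eq_bigr => p _; rewrite avg_sum.
      by apply: eq_bigr => q _; rewrite avgZ.
    apply/funext => y; rewrite expr2 mulr_suml; apply: eq_bigr => p _.
    by rewrite mulr_sumr; apply: eq_bigr => q _; ring.
  by apply: avg_ge0 => y; exact: sqr_ge0.
rewrite -[X in _ <= X]subr0; apply: (@le_trans _ _ (quad l (autocov F f) -
  \sum_(p <- l) \sum_(q <- l)
    p.1 * q.1 * avg F (fun y => f (p.2 + y) * f (q.2 + y)))); last by rewrite lerB.
rewrite /quad -sumrB mulNr mulr_suml -sumrN big_seq [X in _ <= X]big_seq.
apply: ler_sum => p _; rewrite -sumrB mulr_suml -sumrN big_seq [X in _ <= X]big_seq.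
apply: ler_sum => q ql; rewrite -mulrBr.
have shift : `|avg F (fun y => f (p.2 + y) * f (q.2 + y))
               - autocov F f (p.2 - q.2)| <= e.
  apply: le_trans (small _ ql).
  have := @avg_shift F (fun y => f y * f ((p.2 - q.2) + y)) q.2 F0 _.
  have -> : (fun y => f (q.2 + y) * f (p.2 - q.2 + (q.2 + y))) =
            (fun y => f (p.2 + y) * f (q.2 + y)).
    by apply/funext => y; rewrite addrA subrK mulrC.
  by apply=> y; rewrite normrM mulr_ile1.
rewrite lerNl -mulrN opprB; apply: le_trans (ler_norm _) _.
by rewrite normrM ler_wpM2l.
Qed.

(** A correspondence principle: psi is a limit of the autocovariances of
f := 1_E - dens.  If w is not in E - E then 1_E (y) 1_E (w + y) = 0, so that the
autocovariance at w is the average of - dens (1_E (y) + 1_E (w + y)) + dens^2,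
which tends to - dens^2. *)
Theorem dense_positive_definite E : (0%E < upper_banach_density R E)%E ->
  exists2 c, 0 < c & exists psi : G -> R,
    [/\ solves (psd_system `|` upper_system (~` difference_set E) (- c)) psi
      & forall w, `|psi w| <= 1].
Proof.
move=> /dense_folner [F [d [[F0 Feps] d0 dF]]].
exists (d ^+ 2); first exact: exprn_gt0.
pose dens n := density_on R E (F n).
pose f n (y : G) : R := (y \in E)%:R - dens n.
have dens1 n : dens n <= 1.
  rewrite /dens density_on_avg; apply: le_trans (ler_norm _) _.
  by apply: avg_le1 => // y; case: (y \in E); rewrite ?normr1 ?normr0.
have f1 n y : `|f n y| <= 1.
  have := dens1 n; have := dF n; rewrite /f ler_norml -/(dens n).
  by case: (y \in E) => /=; lra.
have [||psi] := @asymptotic_solution R G 1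
    (psd_system `|` upper_system (~` difference_set E) (- d ^+ 2))
    (fun n => autocov (F n) (f n)); last by exists psi.
- move=> n w; apply: avg_le1 => // y.
  by rewrite normrM mulr_ile1.
move=> l b Slb e e0; case: Slb => [[m [-> ->]]|[w Ew [-> ->]]].
- rewrite add0r.
  pose K := \sum_(p <- m) \sum_(q <- m) `|p.1 * q.1|.
  have K0 : 0 <= K by apply: sumr_ge0 => p _; apply: sumr_ge0.
  have e1 : 0 < e / (1 + K) by rewrite divr_gt0 // ltr_pwDl.
  have : \forall n \near \oo, forall q, q \in m -> displacement (F n) q.2 <= e / (1 + K).
    move: (e / (1 + K)) e1 => e' e1; elim: m {K K0} => [|p m IH]; first by apply: nearW.
    near=> n => q; rewrite inE => /orP[/eqP->|]; first by near: n; exact: Feps.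
    by move: q; near: n; exact: IH.
  apply: filterS => n small.
  have := quad_autocov (F0 n) (f1 n) small.
  rewrite /lin big_allpairs_dep -/K => h.
  have -> : \sum_(p <- m) \sum_(q <- m) - (p.1 * q.1) * autocov (F n) (f n) (p.2 - q.2)
     = - quad m (autocov (F n) (f n)).
    rewrite /quad -sumrN; apply: eq_bigr => p _.
    by rewrite -sumrN; apply: eq_bigr => q _; rewrite mulNr.
  rewrite lerNl; apply: le_trans h; rewrite mulNr lerN2 mulrCA.
  apply: ler_piMr; first exact: ltW.
  by rewrite ler_pdivrMr ?mul1r ?lerDr // ltr_pwDl.
- apply: filterS (Feps w e e0) => n small; rewrite lin1 mul1r.
  have := @avg_shift (F n) (fun y => (y \in E)%:R) w (F0 n) _.
  set a := avg _ _ => /(_ _)/le_trans/(_ small) h.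
  have {h} : `|a - dens n| <= e.
    rewrite /dens density_on_avg; apply: h => y.
    by case: (y \in E); rewrite ?normr1 ?normr0.
  rewrite ler_norml => /andP[a1 _].
  have -> : autocov (F n) (f n) w = - dens n * a.
    rewrite /autocov (_ : (fun y => _) = (fun y => - dens n * (y \in E)%:R
        + (- dens n * (w + y \in E)%:R + dens n ^+ 2))).
      rewrite !avgD (avg_cst _ (F0 n)) !avgZ -density_on_avg -[density_on R E (F n)]/(dens n) -/a.
      by move: (dens n) => D; ring.
    apply/funext => y; rewrite /f.
    have [yE|_] := boolP (y \in E); last by rewrite /= mulr0n; ring.
    have [wyE|_] := boolP (w + y \in E); last by rewrite /= mulr0n; ring.
    exfalso; apply: Ew; exists (w + y); first exact: set_mem.
    by exists y; [exact: set_mem|rewrite addrK].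
  have := dF n; rewrite -/(dens n) => dn; have := dens1 n => d1.
  by nra.
Unshelve. all: by end_near. Qed.

End Density.

(** * Positive definite functions and vectors of differences *)

Section PositiveDefinite.
Variables (R : realType) (G : zmodType) (psi : G -> R).
Hypothesis psi1 : forall w, `|psi w| <= 1.
Hypothesis psiN : forall w, psi (- w) = psi w.
Hypothesis psi_psd : forall l, 0 <= quad l psi.

(** In terms of vectors f_w with Gram matrix psi (w - w'), the inner product of
f_(d.1) - f_(d.2) and f_(d'.1) - f_(d'.2). *)
Definition cross (d d' : G * G) : R :=
  psi (d.1 - d'.1) - psi (d.1 - d'.2) - psi (d.2 - d'.1) + psi (d.2 - d'.2).

Lemma cross_sym d d' : cross d d' = cross d' d.
Proof.
rewrite /cross -[psi (d.1 - d'.1)]psiN -[psi (d.1 - d'.2)]psiN.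
rewrite -[psi (d.2 - d'.1)]psiN -[psi (d.2 - d'.2)]psiN !opprB; ring.
Qed.

Lemma cross_le4 d d' : cross d d' <= 4.
Proof.
have := psi1 (d.1 - d'.1); have := psi1 (d.1 - d'.2).
have := psi1 (d.2 - d'.1); have := psi1 (d.2 - d'.2).
by rewrite /cross !ler_norml; lra.
Qed.

(** Cauchy-Schwarz for the unit-bounded vector f_z and the sum of the vectors
f_(d.1) - f_(d.2) over d in D. *)
Lemma difference_bound (z : G) (D : seq (G * G)) :
  (\sum_(d <- D) (psi (z - d.1) - psi (z - d.2))) ^+ 2
    <= \sum_(d <- D) \sum_(d' <- D) cross d d'.
Proof.
pose m : seq (R * G) := flatten [seq [:: (1, d.1); (-1, d.2)] | d <- D].
have linm g : \sum_(p <- m) p.1 * g p.2 = \sum_(d <- D) (g d.1 - g d.2).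
  rewrite /m big_flatten big_map; apply: eq_bigr => d _.
  by rewrite big_cons big_seq1 /= mul1r mulN1r.
set s := \sum_(d <- D) (psi (z - d.1) - psi (z - d.2)).
set Q := \sum_(d <- D) _.
(* The coefficient - s minimises the quadratic form when psi 0 = 1. *)
have := psi_psd ((- s, z) :: m).
have -> : quad ((- s, z) :: m) psi = s ^+ 2 * psi 0 - 2 * s ^+ 2 + Q.
  have row x : \sum_(q <- (- s, z) :: m) q.1 * psi (x - q.2) =
      - s * psi (x - z) + \sum_(d <- D) (psi (x - d.1) - psi (x - d.2)).
    by rewrite big_cons (linm (fun y => psi (x - y))).
  have -> : quad ((- s, z) :: m) psi = \sum_(p <- (- s, z) :: m) p.1 *
      (- s * psi (p.2 - z) + \sum_(d <- D) (psi (p.2 - d.1) - psi (p.2 - d.2))).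
    apply: eq_bigr => p _; rewrite -row mulr_sumr.
    by apply: eq_bigr => q _; rewrite mulrA.
  rewrite big_cons /= subrr -/s.
  rewrite (linm (fun x => - s * psi (x - z) +
     \sum_(d <- D) (psi (x - d.1) - psi (x - d.2)))).
  have -> : \sum_(d <- D) (- s * psi (d.1 - z) +
         \sum_(d0 <- D) (psi (d.1 - d0.1) - psi (d.1 - d0.2)) -
        (- s * psi (d.2 - z) +
         \sum_(d0 <- D) (psi (d.2 - d0.1) - psi (d.2 - d0.2)))) = - s * s + Q.
    have -> : - s * s = \sum_(d <- D) - s * (psi (z - d.1) - psi (z - d.2)).
      by rewrite -mulr_sumr.
    rewrite -big_split; apply: eq_bigr => d _ /=.
    rewrite -[psi (d.1 - z)]psiN -[psi (d.2 - z)]psiN !opprB.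
    have -> : \sum_(d' <- D) cross d d' =
        \sum_(d0 <- D) (psi (d.1 - d0.1) - psi (d.1 - d0.2))
        - \sum_(d0 <- D) (psi (d.2 - d0.1) - psi (d.2 - d0.2)).
      by rewrite -sumrB; apply: eq_bigr => d' _; rewrite /cross; ring.
    by ring.
  by ring.
have := psi1 0; rewrite ler_norml => /andP[_ p01].
have : s ^+ 2 * psi 0 <= s ^+ 2 by rewrite ler_piMr ?sqr_ge0.
lra.
Qed.

End PositiveDefinite.

(** * Torus-invariant positive definite functions on the rational plane *)

Definition torus (t : rat) (w : rat * rat) : rat * rat := (t * w.1, w.2 / t).

Lemma torusC t t' w : torus t (torus t' w) = torus t' (torus t w).
Proof. by rewrite /torus /= mulrCA -!mulrA [t'^-1 * _]mulrC. Qed.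

Section Hyperbolic.
Variables (R : realType) (psi : rat * rat -> R).
Hypothesis psi1 : forall w, `|psi w| <= 1.
Hypothesis psi_psd : forall l, 0 <= quad l psi.
Hypothesis psi_torus : forall t w, t != 0 -> psi (torus t w) = psi w.

Definition profile (t : rat) : R := psi (t, 1).
Local Notation h := profile.

Lemma psi_profile u v : v != 0 -> psi (u, v) = h (u * v).
Proof. by move=> v0; rewrite -(psi_torus (u, v) v0) /torus /= divff // mulrC. Qed.

Lemma psi_axis u : u != 0 -> psi (u, 0) = psi (1, 0).
Proof.
by move=> u0; rewrite -[RHS](psi_torus _ u0) /torus /= mulr1 mul0r.
Qed.

Lemma psi_even w : psi (- w) = psi w.
Proof.
have n1 : (-1 : rat) != 0 by rewrite oppr_eq0 oner_eq0.
rewrite -[RHS](psi_torus _ n1) /torus mulN1r invrN1 mulrN1.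
by case: w.
Qed.

(** Otherwise one finds arbitrarily many disjoint pairs (u, u') with
h u - h u' > e.  The vectors f_(u, 0) - f_(u', 0) are orthogonal, because psi is
constant on the punctured axis, and correlate with f_(0, -1): this contradicts
Bessel's inequality. *)
Lemma profile_oscillation (e : R) : 0 < e ->
  exists B : seq rat, forall s t, s \notin B -> t \notin B -> h s - h t <= e.
Proof.
move=> e0; apply: contrapT => noB.
have bad (B : seq rat) : exists d : rat * rat,
    [/\ d.1 \notin B, d.2 \notin B & e < h d.1 - h d.2].
  apply: contrapT => nod; apply: noB; exists B => s t sB tB.
  by rewrite leNgt; apply/negP => lt; apply: nod; exists (s, t).
pose up (d : rat * rat) : (rat * rat) * (rat * rat) := ((d.1, 0), (d.2, 0)).
have many n : exists D : seq (rat * rat),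
    n%:R * e <= \sum_(d <- D) (h d.1 - h d.2) /\
    \sum_(d <- D) \sum_(d' <- D) cross psi (up d) (up d') <= 4 * n%:R.
  elim: n => [|n [D [big small]]]; first by exists [::]; rewrite !big_nil mul0r mulr0.
  have [d [d1 d2 hd]] := bad (unzip1 D ++ unzip2 D).
  have ortho d' : d' \in D -> cross psi (up d) (up d') = 0.
    move=> d'D.
    have [n1 n2] : d'.1 \in unzip1 D ++ unzip2 D /\ d'.2 \in unzip1 D ++ unzip2 D.
      by split; rewrite mem_cat; apply/orP; [left|right]; apply: map_f.
    have ax x y : x \notin unzip1 D ++ unzip2 D -> y \in unzip1 D ++ unzip2 D ->
        psi ((x, 0) - (y, 0)) = psi (1, 0).
      move=> xD yD; rewrite -[RHS](@psi_axis (x - y)).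
        by congr psi; congr pair; rewrite /= subr0.
      by rewrite subr_eq0; apply: contraNneq xD => ->.
    by rewrite /cross /= !ax //; ring.
  exists (d :: D); split.
    by rewrite big_cons -[n.+1%:R]natr1; move: hd big; lra.
  have row0 : \sum_(d' <- D) cross psi (up d) (up d') = 0.
    by rewrite big_seq big1 // => d' /ortho.
  rewrite big_cons big_cons row0 addr0 [X in _ + X <= _](_ : _ =
      \sum_(d' <- D) \sum_(d'' <- D) cross psi (up d') (up d'')); last first.
    rewrite big_seq [RHS]big_seq; apply: eq_bigr => d' d'D.
    by rewrite big_cons (cross_sym psi_even) ortho // add0r.
  have := cross_le4 psi1 (up d) (up d).
  by rewrite -[n.+1%:R]natr1; move: small; lra.
pose n := (Num.truncn (4 / e ^+ 2)).+1.
have ne : 4 < n%:R * e ^+ 2.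
  by rewrite -ltr_pdivrMr ?exprn_gt0 // truncnS_gt.
have [D [big small]] := many n.
have := difference_bound psi1 psi_even psi_psd (0, -1) (map up D).
rewrite !big_map; under [X in _ <= X -> _]eq_bigr do rewrite big_map.
under eq_bigr => d _.
  have ev x : psi ((0, -1) - (x, 0)) = h x.
    by rewrite -psi_even; congr psi; congr pair; rewrite /= sub0r opprK.
  rewrite !ev; over.
move=> /le_trans/(_ small) sq.
have n0 : 0 < n%:R :> R by rewrite ltr0n.
have : (n%:R * e) ^+ 2 <= 4 * n%:R.
  have nn : 0 <= n%:R * e by rewrite mulr_ge0 // ltW.
  by apply: le_trans sq; rewrite lerXn2r // nnegrE (le_trans nn).
rewrite exprMn expr2 -mulrA [4 * _]mulrC ler_pM2l //.
by rewrite leNgt ne.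
Qed.

(** For ratio q = v / v', the point (a / v, v) - (b / v', v') lies on the hyperbola
whose product of coordinates is a + b - a / q - b q.  The term b q dominates for
large q, so these products leave every bounded set. *)
Lemma hyperbola_escape (s t M : rat) : s != 0 -> t != 0 ->
  exists2 lam, 1 < lam & forall a b q, a \in [:: s; t] -> b \in [:: s; t] ->
    lam <= q -> M < `|a + b - a / q - b * q|.
Proof.
move=> s0 t0.
pose c := Num.min `|s| `|t|; pose C := `|s| + `|t|.
have c0 : 0 < c by rewrite lt_min !normr_gt0 s0.
have inC a : a \in [:: s; t] -> c <= `|a| /\ `|a| <= C.
  rewrite !inE /c /C => /orP[]/eqP->; split.
  - by rewrite ge_min lexx.
  - by rewrite lerDl.
  - by rewrite ge_min lexx orbT.
  - by rewrite lerDr.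
have K0 : 0 <= (`|M| + 3 * C) / c.
  by rewrite divr_ge0 ?(ltW c0) // addr_ge0 // mulr_ge0 // addr_ge0.
exists (2 + (`|M| + 3 * C) / c); first by lra.
move=> a b q /inC[ca aC] /inC[cb bC] lq.
have q1 : 1 <= q by lra.
have q0 : 0 < q by lra.
have cq : `|M| + 3 * C < c * q.
  by rewrite [c * q]mulrC -ltr_pdivrMr //; move: lq; lra.
have bq : c * q <= `|b * q| by rewrite normrM (ger0_norm (ltW q0)) ler_pM2r.
have aq : `|a / q| <= C.
  apply: le_trans aC; rewrite normrM normfV (ger0_norm (ltW q0)).
  by rewrite ler_pdivrMr // ler_peMr.
have : `|b * q| <= `|a + b - a / q - b * q| + `|a| + `|b| + `|a / q|.
  set x := a + b - _ - _.
  have -> : b * q = - x + a + b - a / q by rewrite /x; ring.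
  apply: le_trans (ler_normB _ _) _; rewrite lerD2r.
  apply: le_trans (ler_normD _ _) _; rewrite lerD2r.
  apply: le_trans (ler_normD _ _) _; rewrite lerD2r.
  by rewrite normrN.
by have := ler_norm M; lra.
Qed.


Lemma seq_bounded (B : seq rat) : exists M, forall x, x \in B -> `|x| <= M.
Proof.
exists (\sum_(x <- B) `|x|) => x xB.
by rewrite (big_rem x xB) /= lerDl sumr_ge0.
Qed.

(** The vectors D_v = f_(s/v, v) - f_(t/v, v), for v = lam ^ i and i < n, have inner
product h s - h t with f_0.  The ratios of the v's exceed lam or are below its
inverse, so the mutual inner products only involve values of h outside the
exceptional finite set and are at most 2 e; Cauchy-Schwarz then bounds
(h s - h t) ^ 2 by 2 e + 4 / n. *)
Lemma profile_le s t : s != 0 -> t != 0 -> h s <= h t.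
Proof.
move=> s0 t0; rewrite leNgt -subr_gt0; apply/negP.
set eta := h s - h t => eta0.
pose e := eta ^+ 2 / 4.
have e0 : 0 < e by rewrite divr_gt0 // exprn_gt0.
have [B osc] := profile_oscillation e0.
have [M BM] := seq_bounded B.
have [lam lam1 far] := hyperbola_escape M s0 t0.
have lam0 : 0 < lam by lra.
pose v (i : nat) := lam ^+ i.
have v0 i : v i != 0 by rewrite expf_neq0 // lt0r_neq0.
pose d (i : nat) : (rat * rat) * (rat * rat) := ((s / v i, v i), (t / v i, v i)).
have growth i j : (i < j)%N -> lam <= v j / v i.
  move=> ij; rewrite /v -exprB ?(ltnW ij) ?unitfE ?lt0r_neq0 //.
  by rewrite -[X in X <= _]expr1 ler_weXn2l ?subn_gt0 // ltW.
(* The same product of coordinates, written with v i / v j and with its inverse: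
     whichever of these ratios is large is used below. *)
have prod a b i j : i != j ->
    psi ((a / v i, v i) - (b / v j, v j)) = h (a + b - a / (v i / v j) - b * (v i / v j))
    /\ psi ((a / v i, v i) - (b / v j, v j)) = h (b + a - b / (v j / v i) - a * (v j / v i)).
  move=> ij; have vij : v i - v j != 0.
    rewrite subr_eq0; apply: contraNneq ij => vv.
    case: (ltngtP i j) => // ij; have := growth _ _ ij; rewrite vv divff //; lra.
  have -> : (a / v i, v i) - (b / v j, v j) = (a / v i - b / v j, v i - v j) by [].
  have vi := v0 i; have vj := v0 j.
  by rewrite psi_profile //; split; congr h; field; rewrite vi vj.
have avoid a b i j : i != j -> a \in [:: s; t] -> b \in [:: s; t] ->
    exists2 x, x \notin B & psi ((a / v i, v i) - (b / v j, v j)) = h x.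
  move=> ij aa bb; have [p1 p2] := prod a b i j ij.
  have [lt|lt|eq] := ltngtP i j; last by rewrite eq eqxx in ij.
  - exists (b + a - b / (v j / v i) - a * (v j / v i)) => //.
    apply/negP => /BM; rewrite leNgt => /negP; apply.
    by apply: far => //; exact: growth.
  - exists (a + b - a / (v i / v j) - b * (v i / v j)) => //.
    apply/negP => /BM; rewrite leNgt => /negP; apply.
    by apply: far => //; exact: growth.
have ss : s \in [:: s; t] by rewrite inE eqxx.
have tt : t \in [:: s; t] by rewrite !inE eqxx orbT.
have small i j : i != j -> cross psi (d i) (d j) <= 2 * e.
  move=> ij; rewrite /cross /d /=.
  have [x xB ->] := avoid s s i j ij ss ss.
  have [y yB ->] := avoid s t i j ij ss tt.
  have [z zB ->] := avoid t s i j ij tt ss.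
  have [w wB ->] := avoid t t i j ij tt tt.
  by have := osc _ _ xB yB; have := osc _ _ wB zB; lra.
pose n := (Num.truncn (8 / eta ^+ 2)).+1.
have ne : 8 < n%:R * eta ^+ 2.
  by rewrite -ltr_pdivrMr ?exprn_gt0 // truncnS_gt.
have := difference_bound psi1 psi_even psi_psd 0 [seq d (val i) | i <- index_enum 'I_n].
rewrite !big_map; under [X in _ <= X -> _]eq_bigr do rewrite big_map.
rewrite /=.
have -> : \sum_(i < n) (psi (0 - (s / v i, v i)) - psi (0 - (t / v i, v i))) = n%:R * eta.
  under eq_bigr => i _ do rewrite !sub0r !psi_even !psi_profile // !divfK //.
  by rewrite sumr_const card_ord mulr_natl.
move=> sq.
have : \sum_(i < n) \sum_(j < n) cross psi (d i) (d j) <= n%:R * (4 + n%:R * (2 * e)).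
  have row (i : 'I_n) : \sum_(j < n) cross psi (d i) (d j) <= 4 + n%:R * (2 * e).
    rewrite (bigD1 i) //= lerD ?cross_le4 //.
    apply: (@le_trans _ _ (\sum_(j < n | j != i) 2 * e)).
      by apply: ler_sum => j ji; apply: small; rewrite eq_sym.
    have -> : n%:R * (2 * e) = \sum_(j < n) 2 * e.
      by rewrite sumr_const card_ord [LHS]mulr_natl.
    by rewrite [X in _ <= X](bigD1 i) //= lerDr; lra.
  apply: (le_trans (ler_sum _ (fun i _ => row i))).
  by rewrite sumr_const card_ord [leRHS]mulr_natl.
move=> /(le_trans sq).
have n0 : 0 < n%:R :> R by rewrite ltr0n.
rewrite exprMn expr2 -mulrA ler_pM2l // /e; lra.
Qed.

(** Any two of the points (i, i) differ by a vector off the axes, so that their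
Gram matrix has the constant h t off the diagonal. *)
Lemma profile_ge0 t : t != 0 -> 0 <= h t.
Proof.
move=> t0; rewrite leNgt; apply/negP => ht.
pose n := (Num.truncn (2 / - h t)).+1.
have nh : 2 < n%:R * - h t by rewrite -ltr_pdivrMr ?oppr_gt0 // truncnS_gt.
have := psi_psd [seq (1, ((val i)%:R, (val i)%:R)) | i <- index_enum 'I_n].
rewrite /quad !big_map; under eq_bigr do rewrite big_map.
rewrite /=; apply/negP; rewrite -ltNge.
have row (i : 'I_n) : \sum_(j < n) 1 * 1 *
    psi ((i%:R, i%:R) - (j%:R, j%:R)) <= 2 + n%:R * h t.
  have -> : n%:R * h t = \sum_(j < n) h t by rewrite sumr_const card_ord mulr_natl.
  rewrite (bigD1 i) //= [X in _ <= _ + X](bigD1 i) //= addrA lerD //.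
    have := psi1 (1, t); rewrite psi_profile // mul1r ler_norml => /andP[h1 _].
    have := psi1 ((i%:R, i%:R) - (i%:R, i%:R)); rewrite ler_norml => /andP[_ p1].
    by rewrite !mul1r; lra.
  apply: ler_sum => j ji; rewrite !mul1r.
  have ij : (i%:R - j%:R : rat) != 0.
    by rewrite subr_eq0 eqr_nat eq_sym.
  have -> : ((i%:R, i%:R) - (j%:R, j%:R) : rat * rat) = (i%:R - j%:R, i%:R - j%:R) by [].
  by rewrite psi_profile // profile_le // mulf_neq0.
apply: le_lt_trans (ler_sum _ (fun i _ => row i)) _.
rewrite sumr_const card_ord -[ltLHS]mulr_natl pmulr_rlt0 ?ltr0n //; lra.
Qed.

End Hyperbolic.

Lemma psd_stable (R : realType) (G : zmodType) (T : G -> G) :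
  {morph T : x y / x - y} -> stable T (@psd_system R G).
Proof.
move=> TB l b [m [-> ->]]; exists (pull T m).
rewrite /pull map_allpairs allpairs_mapl allpairs_mapr /=.
by congr pair; apply: eq_allpairs => p q; rewrite /= TB.
Qed.

Lemma torusB t : {morph torus t : x y / x - y}.
Proof. by move=> x y; rewrite /torus /= mulrBr mulrBl. Qed.

(** * Products of coordinates of differences *)

Theorem corollary1p12 (R : realType) (E : set (rat * rat)) :
  (0%E < upper_banach_density R E)%E -> product_set E = [set: rat].
Proof.
move=> dE; apply/seteqP; split=> // r _.
have [c c0 [psi [psi_sol psi1]]] := dense_positive_definite dE.
have [r0|r0] := eqVneq r 0.
  (* Were 0 outside E - E, psi 0 would be negative, although it is a squared norm. *)
  suff : difference_set E 0 by move=> E0; exists 0; rewrite //= mul0r.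
  apply: contrapT => E0.
  have /solvesU[/solves_psd psd /solves_upper up] := psi_sol.
  have := psd [:: (1, 0)]; rewrite /quad !big_seq1 subrr !mul1r.
  by have := up _ E0; lra.
apply: contrapT => nr.
pose D : set (rat * rat) := [set w | w.1 * w.2 = r].
have DE : D `<=` ~` difference_set E by move=> w Dw Ew; apply: nr; exists w.
(* An enumeration of the torus maps of nonzero parameter, padded with torus 1. *)
pose T (i : nat) := torus (odflt 1 (omap val (choice.unpickle i : option {t : rat | t != 0}))).
have T0 i : exists2 t, t != 0 & T i = torus t.
  rewrite /T; case: (choice.unpickle i) => [t|] /=; last by exists 1.
  by exists (val t); first exact: (valP t).
have [||||phi [/solvesU[/solves_psd psd /solves_upper up] phi1 inv]] :=
    @invariant_solution R _ 1 (@psd_system R _ `|` upper_system D (- c)) T psi.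
- move=> i; have [t t0 ->] := T0 i; apply: stableU.
    exact/psd_stable/torusB.
  move=> l b [w Dw [-> ->]]; exists (torus t w) => //.
  by rewrite /D /= -[RHS]Dw; field.
- by move=> i j x; have [t _ ->] := T0 i; have [u _ ->] := T0 j; exact: torusC.
- have /solvesU[s1 /solves_upper s2] := psi_sol.
  by apply/solvesU; split=> //; apply/solves_upper => w /DE; exact: s2.
- exact: psi1.
have phi_torus t w : t != 0 -> phi (torus t w) = phi w.
  by move=> t0; rewrite -[RHS](inv (choice.pickle (Sub t t0 : {t : rat | t != 0}))) /T choice.pickleK.
have := profile_ge0 phi1 psd phi_torus r0.
have := up (r, 1); rewrite /D /= mulr1 => /(_ erefl) h; rewrite /profile; lra.
Qed.
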